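(* Let $q=2^e$ with $e>2$ and let $B\subset\mathbb{P}^2$ be the Ballico-Hefez curve over $\mathbb{F}_q$, i.e. the image of $\Phi:\mathbb{P}^1\to\mathbb{P}^2$, $\Phi(s,t)=(s^{q+1},\,s^{q}t+st^{q},\,t^{q+1})$. Then $C_L(\mathrm{Sing}\,B,\mathcal{O}(1))$ is a $\left[\frac{q^2-q}{2},\,3,\,\frac{q^2-2q}{2}\right]_q$-code, which achieves the Griesmer bound.
   Context: $\mathrm{Sing}\,B$ is the set of singular points of $B$ (over $\overline{\mathbb{F}}_q$); all of them are $\mathbb{F}_q$-rational, so $\mathrm{Sing}\,B\subset\mathbb{P}^2(\mathbb{F}_q)$. For a subset $S\subset\mathbb{P}^2(\mathbb{F}_q)$ with $s$ elements, fix for each $P\in S$ a representative $(a_0,a_1,a_2)\in\mathbb{F}_q^3$ of its homogeneous coordinates, so that $F(P)\in\mathbb{F}_q$ is defined for every homogeneous polynomial $F(X_0,X_1,X_2)$ over $\mathbb{F}_q$. Let $\Gamma(\mathcal{O}(i))$ be the $\mathbb{F}_q$-vector space of homogeneous polynomials of degree $i$ in $X_0,X_1,X_2$ over $\mathbb{F}_q$ (including $0$). The linear code $C_L(S,\mathcal{O}(i))\subset\mathbb{F}_q^s$ is the image of the $\mathbb{F}_q$-linear map $\Gamma(\mathcal{O}(i))\to\mathbb{F}_q^{s}$, $F\mapsto(F(P))_{P\in S}$. An $[n,k,d]_q$-code is an $\mathbb{F}_q$-linear code of length $n$, dimension $k$ and minimum distance (exactly) $d$. Such a code achieves the Griesmer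 bound if $n=\sum_{i=0}^{k-1}\lceil d/q^i\rceil$. *)

(* Defs.v *)
From HB Require Import structures.
From mathcomp Require Import all_boot all_order all_algebra all_field.
From mathcomp Require Import mpoly.

Set Implicit Arguments.
Unset Strict Implicit.
Unset Printing Implicit Defensive.

Import GRing.Theory Num.Theory.
Local Open Scope ring_scope.

(* A point of P^2(K) is represented by a nonzero row vector of homogeneous
   coordinates; two nonzero rows x, y represent the same point iff
   (x == y)%MS, i.e. iff they span the same line. A set of points of P^2 is a
   predicate on rows that implies nonzero and is invariant under this
   equivalence. *)

Definition projset (K : fieldType) := 'rV[K]_3 -> Prop.

Definition Phi (K : fieldType) (q : nat) (s t : K) : 'rV[K]_3 :=
  \row_(i < 3) [:: s ^+ q.+1; s ^+ q * t + s * t ^+ q; t ^+ q.+1]`_i.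

Definition ballico_hefez (K : fieldType) (q : nat) : projset K :=
  fun P => P != 0 /\
    exists s t : K, (s, t) != (0, 0) /\ (P == Phi q s t)%MS.
Arguments ballico_hefez : clear implicits.

Definition vanishes_on (K : fieldType) (X : projset K) (f : {mpoly K[3]}) :=
  forall P, X P -> f.@[P ord0] = 0.

(* Jacobian criterion for a plane curve X (codimension 1): a point of X is
   singular iff the Jacobian matrix of the homogeneous ideal of X has rank 0
   there, i.e. iff the gradients of all homogeneous polynomials vanishing on X
   vanish at that point. It is meant for K algebraically closed. *)
Definition Sing (K : fieldType) (X : projset K) : projset K :=
  fun P => X P /\
    forall (d : nat) (f : {mpoly K[3]}),
      f \is d.-homog -> vanishes_on X f ->
      forall i : 'I_3, (f^`M(i)).@[P ord0] = 0.

(* iota : F -> K presents K as an algebraic closure of F. *)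
Definition is_alg_closure (F : fieldType) (K : closedFieldType)
    (iota : {rmorphism F -> K}) :=
  forall x : K, algebraicOver iota x.

Definition rational_points (F K : fieldType) (iota : {rmorphism F -> K})
    (X : projset K) : projset F :=
  fun P => X (map_mx iota P).

Definition all_rational (F K : fieldType) (iota : {rmorphism F -> K})
    (X : projset K) :=
  forall P, X P -> exists R : 'rV[F]_3, (P == map_mx iota R)%MS.

(* r lists the s points of S, choosing one coordinate vector for each. *)
Definition representatives (F : fieldType) (S : projset F) (s : nat)
    (r : 'I_s -> 'rV[F]_3) :=
  [/\ forall j, r j != 0 /\ S (r j),
      forall j k, (r j == r k)%MS -> j = k
    & forall P, S P -> exists j, (P == r j)%MS].

Definition evalS (F : fieldType) (s : nat) (r : 'I_s -> 'rV[F]_3) (i : nat)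
    (f : dhomog 3 F i) : 'rV[F]_s :=
  \row_(j < s) (mpoly_of_dhomog f).@[r j ord0].

Lemma evalS_is_linear (F : fieldType) (s : nat) (r : 'I_s -> 'rV[F]_3) i :
  linear (@evalS F s r i).
Proof.
by move=> a f g; apply/rowP=> j; rewrite !mxE linearP.
Qed.

HB.instance Definition _ (F : fieldType) (s : nat) (r : 'I_s -> 'rV[F]_3) i :=
  GRing.isLinear.Build F (dhomog 3 F i) 'rV[F]_s *:%R (@evalS F s r i)
    (@evalS_is_linear F s r i).

Definition C_L (F : fieldType) (s : nat) (r : 'I_s -> 'rV[F]_3) (i : nat) :
    {vspace 'rV[F]_s} :=
  limg (linfun (@evalS F s r i)).

Lemma C_LP (F : fieldType) (s : nat) (r : 'I_s -> 'rV[F]_3) (i : nat) c :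
  reflect (exists f : dhomog 3 F i, c = evalS r f) (c \in C_L r i).
Proof.
apply: (iffP memv_imgP) => [[f _ ->]|[f ->]]; exists f; rewrite ?memvf //.
  by rewrite lfunE.
by rewrite lfunE.
Qed.

Definition hamming (F : fieldType) (s : nat) (x y : 'rV[F]_s) : nat :=
  #|[set j : 'I_s | x 0 j != y 0 j]|.

Definition min_distance (F : fieldType) (s : nat) (C : {vspace 'rV[F]_s})
    (d : nat) :=
  (exists x y, [/\ x \in C, y \in C, x != y & hamming x y = d]) /\
  (forall x y, x \in C -> y \in C -> x != y -> (d <= hamming x y)%N).

Definition is_code (F : fieldType) (s : nat) (C : {vspace 'rV[F]_s})
    (n k d : nat) :=
  [/\ s = n, (\dim C)%N = k & min_distance C d].

Definition achieves_griesmer (q n k d : nat) :=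
  n%:Z = \sum_(i < k) Num.ceil (d%:R / q%:R ^+ i : rat).

(* Main.v *)
Require Import Defs.
From HB Require Import structures.
From mathcomp Require Import all_boot all_order all_algebra all_field.
From mathcomp Require Import mpoly ring zify.

Set Implicit Arguments.
Unset Strict Implicit.
Unset Printing Implicit Defensive.

Import GRing.Theory Num.Theory.
Local Open Scope ring_scope.

(** Write a point of P^2 as (x : y : z), and let Tr(a) be the sum of the
    a^(2^i) for i < e, which is the trace of F_q over F_2 when a is in F_q.

    On the curve x, y, z equal s^(q+1), a + b, t^(q+1) with a = s^q t and
    b = s t^q, so x z = a b.  In characteristic 2 the sum of
    (a b)^(2^i) (a + b)^(q+1-2^(i+1)) telescopes ([abs_trace_homogenized]), and
    this yields an equation of degree q+1 that vanishes on the curve: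

      x^q z + x z^q + y^(q+1) + sum_(i < e) (x z)^(2^i) y^(q+1-2^(i+1)).

    Its gradient at (x : y : z) is zero only if y is nonzero, both x/y and z/y
    are fixed by the q-Frobenius map, and Tr(xz/y^2) = 1
    ([singular_rational]).  In particular singular points are rational.
    Conversely, if x and z are in F_q and Tr(xz) = 1, then the roots u and u+1
    of U^2 + U = xz in an algebraic closure are exchanged by Frobenius, and
    (x : 1 : z) is the image of the two parameters u/z and (u+1)/z.  The
    curve has two branches there with different tangent lines, so that every
    form vanishing on it has zero gradient ([node_singular]).  Hence the
    singular points are the (x : 1 : z) with Tr(xz) = 1
    ([rational_singular]).

    Since Tr takes the value 1 on exactly q/2 elements, there are (q-1) q/2
    such points.  On a line x = beta y + gamma z the condition becomes
    Tr((beta^2 + gamma) z^2) = 1, because Tr(w) = Tr(w^2), so such a line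
    contains 0 or q/2 of the points.  Exchanging x and z covers the other
    lines except y = 0, which contains none of the points
    ([card_line_nodes]); the bound q/2 is attained by the line x = y
    ([card_line_nodes_eq]).  The minimum weight is therefore
    (q-1) q/2 - q/2 = (q-2) q/2; it is positive, so that no nonzero linear form
    evaluates to zero and the dimension is 3. *)

(** * Coordinates in the projective plane *)

Local Notation o0 := (@Ordinal 3 0 isT).
Local Notation o1 := (@Ordinal 3 1 isT).
Local Notation o2 := (@Ordinal 3 2 isT).

Definition vec3 (R : nzRingType) (a b c : R) : 'rV[R]_3 :=
  \row_(i < 3) [:: a; b; c]`_i.

Lemma ord3P (P : 'I_3 -> Prop) : P o0 -> P o1 -> P o2 -> forall i, P i.
Proof.
move=> h0 h1 h2 [[|[|[|i]]] hi] //; move: h0 h1 h2;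
  by rewrite (bool_irrelevance hi isT).
Qed.

Lemma sum3E (R : nzRingType) (G : 'I_3 -> R) :
  \sum_(i < 3) G i = G o0 + G o1 + G o2.
Proof.
rewrite !big_ord_recl big_ord0 addr0 addrA.
by congr (G _ + G _ + G _); apply: val_inj.
Qed.

Lemma vec3_eta (R : nzRingType) (P : 'rV[R]_3) :
  P = vec3 (P 0 o0) (P 0 o1) (P 0 o2).
Proof. by apply/rowP; apply: ord3P; rewrite mxE. Qed.

Lemma scale_vec3 (R : nzRingType) (l a b c : R) :
  l *: vec3 a b c = vec3 (l * a) (l * b) (l * c).
Proof. by apply/rowP; apply: ord3P; rewrite !mxE. Qed.

Lemma map_vec3 (R S : nzRingType) (f : {rmorphism R -> S}) (a b c : R) :
  map_mx f (vec3 a b c) = vec3 (f a) (f b) (f c).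
Proof. by apply/rowP; apply: ord3P; rewrite !mxE. Qed.

Lemma eqmx_rowP (K : fieldType) n (P Q : 'rV[K]_n) :
  P != 0 -> (P == Q)%MS -> exists2 l, l != 0 & P = l *: Q.
Proof.
move=> nzP /andP[/sub_rVP[l eqP] _]; exists l => //.
by apply: contraNneq nzP => l0; rewrite eqP l0 scale0r.
Qed.

Lemma eqmx_scale_row (K : fieldType) n (l : K) (Q : 'rV[K]_n) :
  l != 0 -> (l *: Q == Q)%MS.
Proof. by move=> nzl; apply/eqmxP/eqmx_scale. Qed.

(** * Differentiating a polynomial along a parametrized curve *)

Section ChainRule.
Variables (R : comNzRingType) (n : nat).
Implicit Types (f g : {mpoly R[n]}) (v : 'I_n -> R) (c : 'I_n -> {poly R}).

Lemma horner_mmap c f a :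
  (mmap polyC c f).[a] = f.@[fun i => (c i).[a]].
Proof.
rewrite [mmap _ _ _]/mmap mevalE horner_sum; apply: eq_bigr => m _.
rewrite hornerM hornerC /mmap1 horner_prod; congr (_ * _).
by apply: eq_bigr => i _; rewrite horner_exp.
Qed.

Lemma mderivU (i j : 'I_n) : ('X_i : {mpoly R[n]})^`M(j) = (i == j)%:R.
Proof.
rewrite mderivX mnm1E; case: eqP => [->|_]; last by rewrite scale0r.
rewrite scale1r (_ : (U_(j) - U_(j))%MM = 0%MM) ?mpolyX0 //.
by apply/mnmP=> k; rewrite mnmBE subnn mnm0E.
Qed.

Lemma meval_mderivU v i j : (('X_i : {mpoly R[n]})^`M(j)).@[v] = (i == j)%:R.
Proof. by rewrite mderivU rmorph_nat. Qed.

(** The chain rule.  It holds for the variables and is stable under products by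
    Leibniz, hence holds for monomials, and it is linear in [f]. *)
Lemma deriv_mmap c f :
  (mmap polyC c f)^`() = \sum_i mmap polyC c f^`M(i) * (c i)^`().
Proof.
pose D g := (mmap polyC c g)^`() = \sum_i mmap polyC c g^`M(i) * (c i)^`().
have DM g h : D g -> D h -> D (g * h).
  rewrite /D rmorphM derivM => -> ->.
  rewrite mulr_suml mulr_sumr -big_split; apply: eq_bigr => i _ /=.
  by rewrite mderivM rmorphD !rmorphM /=; ring.
have D1 : D 1.
  rewrite /D rmorph1 derivC big1 // => i _.
  by rewrite -mpolyC1 mderivC rmorph0 mul0r.
have DX i : D 'X_i.
  rewrite /D mmapX mmap1U (bigD1 i) //= big1 => [|j neq].
    by rewrite mderivU eqxx rmorph1 mul1r addr0.
  by rewrite mderivU eq_sym (negPf neq) rmorph0 mul0r.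
have DXm m : D 'X_[m].
  rewrite mpolyXE_id; apply: big_ind => // i _.
  by elim: (m i) => [|k IHk]; rewrite ?expr0 // exprS; apply: DM.
elim/mpolyind: f => [|a m f _ _ IH].
  by rewrite rmorph0 deriv0 big1 // => i _; rewrite mderiv0 rmorph0 mul0r.
rewrite rmorphD derivD IH /= mmapZ derivM derivC mul0r add0r DXm mulr_sumr.
rewrite -big_split; apply: eq_bigr => i _ /=.
by rewrite mderivD mderivZ rmorphD /= mmapZ; ring.
Qed.

Lemma meval_mderiv_sum (I : Type) (r : seq I) (G : I -> {mpoly R[n]}) j v :
  ((\sum_(i <- r) G i)^`M(j)).@[v] = \sum_(i <- r) ((G i)^`M(j)).@[v].
Proof. by rewrite (raddf_sum (mderiv j)) raddf_sum. Qed.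

Lemma meval_mderivXn v f k i :
  ((f ^+ k)^`M(i)).@[v] = k%:R * (f^`M(i).@[v] * f.@[v] ^+ k.-1).
Proof.
elim: k => [|k IHk]; first by rewrite expr0 -mpolyC1 mderivC meval0 mul0r.
rewrite exprS mderivM mevalD !mevalM IHk rmorphXn /= -addn1 natrD.
by case: k {IHk} => [|k] /=; rewrite ?exprS; ring.
Qed.
End ChainRule.

(** The gradient of a polynomial that vanishes on [X] is orthogonal to the
    velocity of every polynomial curve inside [X]: the composite is a univariate
    polynomial that is zero at each point of an infinite field, hence is the
    zero polynomial, as is its derivative. *)
Lemma gradient_along_curve (K : closedFieldType) (X : projset K) f
    (c : 'I_3 -> {poly K}) (a : K) :
  vanishes_on X f -> (forall b, X (\row_i (c i).[b])) ->
  \sum_i f^`M(i).@[(\row_i (c i).[a]) ord0] * (c i)^`().[a] = 0.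
Proof.
move=> fX cX.
have f0 : mmap polyC c f = 0.
  apply/eqP; case: (altP eqP) => // /closed_nonrootP[b /negP[]].
  rewrite /root horner_mmap -(fX _ (cX b)); apply/eqP/meval_eq => i.
  by rewrite mxE.
have := deriv_mmap c f; rewrite f0 deriv0 => /(congr1 (horner^~ a)).
rewrite horner0 horner_sum => h; rewrite [RHS]h; apply: eq_bigr => i _.
by rewrite hornerM horner_mmap; congr (_ * _); apply: meval_eq => j; rewrite mxE.
Qed.

(** * The trace polynomial in characteristic 2 *)

(** On a field with [2 ^ e] elements this is the trace to the prime field; the
    same polynomial is also evaluated in the algebraic closure. *)
Definition abs_trace (R : nzRingType) (e : nat) (a : R) : R :=
  \sum_(i < e) a ^+ (2 ^ i).

Lemma rmorph_abs_trace (R S : nzRingType) (f : {rmorphism R -> S}) e a :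
  f (abs_trace e a) = abs_trace e (f a).
Proof. by rewrite rmorph_sum; apply: eq_bigr => i _; rewrite rmorphXn. Qed.

Lemma abs_trace_0 (R : nzRingType) e : abs_trace e (0 : R) = 0.
Proof.
by rewrite /abs_trace big1 // => i _; rewrite expr0n eqn0Ngt (expn_gt0 2).
Qed.

Section Char2.
Variables (R : comNzRingType) (ch2 : 2%N \in [pchar R]).

Lemma expr2XD e (a b : R) : (a + b) ^+ (2 ^ e) = a ^+ (2 ^ e) + b ^+ (2 ^ e).
Proof. by apply: exprDn_pchar; rewrite pnatX pnatE ?ch2. Qed.

Lemma natr_exp2 k : (2 ^ k)%:R = (k == 0)%:R :> R.
Proof. by case: k => [//|k]; rewrite expnS natrM (pcharf0 ch2) mul0r. Qed.

Lemma abs_traceD e (a b : R) :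
  abs_trace e (a + b) = abs_trace e a + abs_trace e b.
Proof.
by rewrite /abs_trace -big_split; apply: eq_bigr => i _; rewrite expr2XD.
Qed.

(** Since [a * b = a ^+ 2 + a * (a + b)] in characteristic 2, each summand is
    the difference of two consecutive values of
    [a ^+ (2 ^ i) * (a + b) ^+ ((2 ^ e).+1 - 2 ^ i)], so the sum telescopes.
    After division by [(a + b) ^+ (2 ^ e).+1] the left-hand side is the trace of
    [a * b / (a + b) ^+ 2]. *)
Lemma abs_trace_homogenized e (a b : R) :
  \sum_(i < e) (a * b) ^+ (2 ^ i) * (a + b) ^+ ((2 ^ e).+1 - 2 ^ i.+1) =
    a * (a + b) ^+ (2 ^ e) + a ^+ (2 ^ e) * (a + b).
Proof.
pose h i := a ^+ (2 ^ i) * (a + b) ^+ ((2 ^ e).+1 - 2 ^ i).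
rewrite (eq_bigr (fun i : 'I_e => h i.+1 - h i)) => [|i _]; last first.
  have le_i : (2 ^ i.+1 <= 2 ^ e)%N by rewrite leq_exp2l.
  rewrite -{1}[a * b](addrK (a * a)) -[_ - _]addrC oppr_pchar2 // -mulrDr.
  rewrite (_ : b + a = a + b) 1?addrC //.
  rewrite expr2XD !exprMn mulrDl oppr_pchar2 // /h addrC; congr (_ + _).
    by rewrite -exprD addnn -mul2n -expnS.
  rewrite -mulrA -exprD; congr (_ * _ ^+ _).
  by move: le_i; rewrite expnS; lia.
rewrite -(big_mkord xpredT (fun i => h i.+1 - h i)) telescope_sumr //.
by rewrite oppr_pchar2 // /h subSnn expr1 expn0 expr1 subSS subn0 addrC.
Qed.

(** The case [a + b = 1] of the previous sum. *)
Lemma abs_trace_artin_schreier e (u : R) :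
  abs_trace e (u * (u + 1)) = u ^+ (2 ^ e) + u.
Proof.
have -> : abs_trace e (u * (u + 1)) =
    \sum_(i < e) (u * (u + 1)) ^+ (2 ^ i)
                   * (u + (u + 1)) ^+ ((2 ^ e).+1 - 2 ^ i.+1).
  by apply: eq_bigr => i _; rewrite addrA addrr_pchar2 // add0r expr1n mulr1.
by rewrite abs_trace_homogenized addrA addrr_pchar2 // add0r expr1n !mulr1 addrC.
Qed.
End Char2.

(** * An equation of the Ballico-Hefez curve *)

Definition bh_eqn (R : comNzRingType) (e : nat) : {mpoly R[3]} :=
  'X_o0 ^+ (2 ^ e) * 'X_o2 + 'X_o0 * 'X_o2 ^+ (2 ^ e) + 'X_o1 ^+ (2 ^ e).+1
  + \sum_(i < e) ('X_o0 * 'X_o2) ^+ (2 ^ i) * 'X_o1 ^+ ((2 ^ e).+1 - 2 ^ i.+1).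

Lemma bh_eqn_homog (R : comNzRingType) e : bh_eqn R e \is (2 ^ e).+1.-homog.
Proof.
have hX i : ('X_i : {mpoly R[3]}) \is 1.-homog by rewrite dhomogX /= mdeg1.
have hXn i k : ('X_i ^+ k : {mpoly R[3]}) \is k.-homog.
  by rewrite -{2}[k]mul1n; apply: dhomogMn.
rewrite /bh_eqn !rpredD //.
- by rewrite -(addn1 (2 ^ e)); apply: dhomogM.
- by rewrite -(add1n (2 ^ e)); apply: dhomogM.
apply: rpred_sum => i _.
have le_i : (2 ^ i.+1 <= 2 ^ e)%N by rewrite leq_exp2l.
have := dhomogM (dhomogMn (2 ^ i) (dhomogM (hX o0) (hX o2)))
                (hXn o1 ((2 ^ e).+1 - 2 ^ i.+1)%N).
rewrite (_ : (1 + 1) * 2 ^ i + _ = (2 ^ e).+1)%N //.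
by move: le_i; rewrite expnS; lia.
Qed.

(** The scalar [l] can be carried through the computation because, with
    [a = l s^q t] and [b = l s t^q], the coordinates satisfy [y = a + b],
    [x z = a b], [x^q z = a^(q+1)] and [x z^q = b^(q+1)] for every [l]. *)
Lemma bh_eqn_vanishes (K : fieldType) (ch2 : 2%N \in [pchar K]) e (l s t : K) :
  (bh_eqn K e).@[(l *: Phi (2 ^ e) s t) ord0] = 0.
Proof.
rewrite /bh_eqn !mevalD !mevalM raddf_sum !rmorphXn /= !mevalXU !mxE /=.
set q := (2 ^ e)%N.
set a := l * (s ^+ q * t); set b := l * (s * t ^+ q).
rewrite (eq_bigr (fun i : 'I_e =>
    (a * b) ^+ (2 ^ i) * (a + b) ^+ (q.+1 - 2 ^ i.+1))).
  rewrite abs_trace_homogenized //.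
  have -> : (l * s ^+ q.+1) ^+ q * (l * t ^+ q.+1) = a ^+ q * a.
    by rewrite /a !exprS !exprMn; ring.
  have -> : l * s ^+ q.+1 * (l * t ^+ q.+1) ^+ q = b ^+ q * b.
    by rewrite /b !exprS !exprMn; ring.
  rewrite mulrDr -/a -/b exprS expr2XD // -/q.
  set A := a ^+ q; set B := b ^+ q.
  rewrite (_ : _ + _ = (2 * (a * A) + b * B + A * b + a * B) *+ 2); last first.
    by ring.
  by rewrite mulrn_pchar.
move=> i _; rewrite mevalM !rmorphXn /= mevalM !mevalXU !mxE /= -mulrDr.
congr (_ ^+ _ * _); rewrite /a /b !exprS; ring.
Qed.

Lemma bh_eqn_vanishes_on (K : fieldType) (ch2 : 2%N \in [pchar K]) e :
  vanishes_on (ballico_hefez K (2 ^ e)) (bh_eqn K e).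
Proof.
move=> P [nzP [s [t [_ /(eqmx_rowP nzP)[l _ ->]]]]].
exact: bh_eqn_vanishes.
Qed.

Section Gradient.
Variables (R : comNzRingType) (ch2 : 2%N \in [pchar R]) (e : nat) (x y z : R).
Hypothesis e_gt0 : (0 < e)%N.
Let q := (2 ^ e)%N.

(** Of the sum in the equation, only the term [i = 0] contributes to the
    derivatives in the outer variables, since the exponents [2 ^ i] of the others
    are even; its exponents in the middle variable are all odd. *)
Lemma bh_eqn_mderiv j :
  ((bh_eqn R e)^`M(j)).@[vec3 x y z ord0] =
    x ^+ q * (o2 == j)%:R + (o0 == j)%:R * z ^+ q + (o1 == j)%:R * y ^+ q
    + ((o0 == j)%:R * z + x * (o2 == j)%:R) * y ^+ q.-1
    + (o1 == j)%:R * \sum_(i < e) (x * z) ^+ (2 ^ i) * y ^+ (q - 2 ^ i.+1).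
Proof.
have q0 : (2 ^ e)%:R = 0 :> R by rewrite (natr_exp2 ch2) eqn0Ngt e_gt0.
rewrite /bh_eqn !mderivD !mderivM !mevalD !mevalM meval_mderiv_sum.
rewrite !meval_mderivXn !rmorphXn /= !mevalXU !meval_mderivU !mxE /=.
rewrite -[in (2 ^ e).+1%:R]addn1 natrD q0.
rewrite !mul0r mulr0 !(addr0, add0r) mul1r -[RHS]addrA; congr (_ + _).
rewrite (eq_bigr (fun i : 'I_e =>
  ((o0 == j)%:R * z + x * (o2 == j)%:R) * y ^+ q.-1 * (i == 0 :> nat)%:R
  + (o1 == j)%:R * ((x * z) ^+ (2 ^ i) * y ^+ (q - 2 ^ i.+1)))).
  rewrite big_split -mulr_sumr /= -mulr_sumr.
  rewrite (_ : \sum_(i < e) (i == 0 :> nat)%:R = 1) ?mulr1 //.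
  by case: (e) e_gt0 => // e' _; rewrite big_ord_recl big1 ?addr0.
move=> i _.
have le_i : (2 ^ i.+1 <= 2 ^ e)%N by rewrite leq_exp2l.
rewrite subSn // -/q; set k := (q - 2 ^ i.+1)%N.
have k1 : k.+1%:R = 1 :> R.
  by rewrite -addn1 natrD natrB // q0 (natr_exp2 ch2) subrr add0r.
rewrite mderivM mevalD !mevalM !meval_mderivXn !rmorphXn /= mderivM mevalD !mevalM.
rewrite !mevalXU !meval_mderivU !mxE /= (natr_exp2 ch2) k1 mul1r.
case: (i =P 0 :> nat) => [i0|_]; last by rewrite !mulr0 !mul0r; ring.
rewrite i0 expn0 expr0 expr1 (_ : k.+1 = q.-1); first by ring.
by rewrite /k i0 /q; move: le_i; rewrite i0 expn1; lia.
Qed.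
End Gradient.

(** * Singular points *)

Lemma frobenius_fixed_rational (F : finFieldType) (K : fieldType)
    (iota : {rmorphism F -> K}) (x : K) :
  x ^+ #|F| = x -> exists a, x = iota a.
Proof.
move=> xq; have: (map_poly iota ('X^#|F| - 'X)).[x] = 0.
  by rewrite rmorphB /= map_polyXn map_polyX !hornerE xq subrr.
rewrite finField_genPoly rmorph_prod horner_prod => /eqP/prodf_eq0[a _].
by rewrite /= map_polyXsubC !hornerE subr_eq0 => /eqP; exists a.
Qed.

Section Singular.
Variables (F : finFieldType) (K : closedFieldType) (iota : {rmorphism F -> K}).
Variable e : nat.
Hypotheses (e_gt0 : (0 < e)%N) (cardF : #|F| = (2 ^ e)%N).

Lemma pchar2_base : 2%N \in [pchar F].
Proof. exact: card_finPcharP cardF _. Qed.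

Lemma pchar2_closure : 2%N \in [pchar K].
Proof. by rewrite (fmorph_pchar iota) pchar2_base. Qed.

Local Notation ch2 := pchar2_closure.

(** At a zero of the gradient of [bh_eqn] the outer derivatives read
    [z^q + z y^(q-1) = 0] and [x^q + x y^(q-1) = 0].  They force [y <> 0], as
    otherwise all coordinates would be zero, and then say that [x / y] and
    [z / y] are Frobenius fixed; the middle derivative, divided by [y^q], is
    [1 + Tr (xz/y^2)]. *)
Lemma singular_rational P : Sing (ballico_hefez K (2 ^ e)) P ->
  exists y a c, [/\ y != 0, abs_trace e (a * c) = 1
                  & P = y *: vec3 (iota a) 1 (iota c)].
Proof.
move=> [BP gradP]; have [nzP _] := BP.
have grad j := gradP _ _ (bh_eqn_homog K e) (bh_eqn_vanishes_on ch2 (e := e)) j.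
rewrite (vec3_eta P) in nzP grad *.
move: (P 0 o0) (P 0 o1) (P 0 o2) nzP grad => x y z nzP grad.
have {}grad j := etrans (esym (bh_eqn_mderiv ch2 x y z e_gt0 j)) (grad j).
have := grad o0; have := grad o1; have := grad o2.
rewrite /= !(mulr0, mul0r, mulr1, mul1r, addr0, add0r).
set q := (2 ^ e)%N => gz gy gx.
have q_gt0 : (0 < q)%N by rewrite expn_gt0.
have nzy : y != 0.
  apply: contraNneq nzP => y0; move: gx gz; rewrite y0 expr0n.
  have -> : (q.-1 == 0)%N = false.
    by rewrite /q -(prednK e_gt0) expnS; have := expn_gt0 2 e.-1; lia.
  rewrite !mulr0 !addr0 => /eqP + /eqP; rewrite !expf_eq0 q_gt0 /=.
  by move=> /eqP-> /eqP->; apply/eqP/rowP; apply: ord3P; rewrite !mxE.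
have frob w : w ^+ q + w * y ^+ q.-1 = 0 -> (w / y) ^+ q = w / y.
  move/eqP; rewrite addr_eq0 oppr_pchar2 ?ch2 // => /eqP wq.
  by rewrite expr_div_n wq -(prednK q_gt0) exprS /=; field; rewrite nzy expf_neq0.
have [a xa] : exists a, x / y = iota a.
  by apply: frobenius_fixed_rational; rewrite cardF; apply: frob.
have [c zc] : exists c, z / y = iota c.
  by apply: frobenius_fixed_rational; rewrite cardF; apply: frob.
exists y, a, c; split=> //; last first.
  by rewrite scale_vec3 -xa -zc mulr1 ![y * _]mulrC !divfK.
have tr0 : y ^+ q * (1 + abs_trace e (iota (a * c))) = 0.
  rewrite -[RHS]gy mulrDr mulr1 /abs_trace mulr_sumr; congr (_ + _).
  apply: eq_bigr => i _.
  have le_i : (2 ^ i.+1 <= q)%N by rewrite leq_exp2l.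
  rewrite -{1}(subnKC le_i) exprD rmorphM -xa -zc mulrAC expnS exprM -exprMn.
  by congr (_ ^+ _ * _); field.
apply: (fmorph_inj iota); rewrite rmorph_abs_trace rmorph1; apply/eqP.
move/eqP: tr0; rewrite mulf_eq0 expf_eq0 (negPf nzy) andbF /=.
by rewrite addr_eq0 oppr_pchar2 ?ch2 // eq_sym.
Qed.

(** The parameters [s] and [s'] have the same image because the norm and the
    trace of [s] over the Frobenius map are symmetric in [s] and [s'].  The
    branches through it have velocities proportional to [(s^q, 1, 0)] and
    [(s'^q, 1, 0)]; with [s <> s'] these kill the first two partial derivatives.
    The third one is killed by moving the parameter [t], with velocity
    proportional to [(0, s^q, 1)] at [t = 1]. *)
Lemma node_singular (l s s' : K) :
    l != 0 -> s ^+ (2 ^ e) = s' -> s' ^+ (2 ^ e) = s -> s != s' ->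
  Sing (ballico_hefez K (2 ^ e)) (l *: Phi (2 ^ e) s 1).
Proof.
set q := (2 ^ e)%N => nzl sq s'q ne.
have q0 : q%:R = 0 :> K by rewrite (natr_exp2 ch2) eqn0Ngt e_gt0.
have q1 : q.+1%:R = 1 :> K by rewrite -addn1 natrD q0 add0r.
have vec3_neq0 (a b c : K) : (a != 0) || (c != 0) -> vec3 a b c != 0.
  apply: contraTneq => /rowP h; have:= h o0; have := h o2; rewrite !mxE /=.
  by move=> -> ->; rewrite eqxx.
have onB (u t : K) : (u != 0) || (t != 0) -> ballico_hefez K q (l *: Phi q u t).
  move=> nz; split; last exists u, t; last split.
  - rewrite scaler_eq0 negb_or nzl; apply: vec3_neq0.
    by rewrite !expf_eq0.
  - by rewrite xpair_eqE negb_and.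
  - exact: eqmx_scale_row.
split; first by apply: onB; rewrite oner_eq0 orbT.
move=> d f _ fB.
set P := (l *: Phi q s 1).
(* The two families of curves [s |-> l *: Phi q s 1], [t |-> l *: Phi q u t]. *)
pose c1 := @vec3 {poly K} (l *: 'X^(q.+1)) (l *: ('X^q + 'X)) l%:P.
pose c2 (u : K) := @vec3 {poly K}
  (l * u ^+ q.+1)%:P (l *: (u ^+ q *: 'X + u *: 'X^q)) (l *: 'X^(q.+1)).
have derivXE n u : ('X^n)^`().[u] = n%:R * u ^+ n.-1 :> K.
  by rewrite derivXn hornerMn hornerXn mulr_natl.
have c1E u : \row_i (c1 ord0 i).[u] = l *: Phi q u 1.
  by apply/rowP; apply: ord3P; rewrite !mxE /= !hornerE ?expr1n ?mulr1.
have c2E u t : \row_i (c2 u ord0 i).[t] = l *: Phi q u t.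
  by apply/rowP; apply: ord3P; rewrite !mxE /= !hornerE.
have branch1 u : l *: Phi q u 1 = P ->
    f^`M(o0).@[P ord0] * u ^+ q + f^`M(o1).@[P ord0] = 0.
  move=> uP.
  have Xc b : ballico_hefez K q (\row_i (c1 ord0 i).[b]).
    by rewrite c1E; apply: onB; rewrite oner_eq0 orbT.
  have := gradient_along_curve u fB Xc; rewrite c1E uP sum3E !mxE /=.
  rewrite !derivZ derivD derivX derivC !hornerZ hornerD !derivXE !hornerC.
  rewrite q1 q0 /= !mul0r !add0r mulr0 addr0 mul1r mulr1 => h.
  by apply: (mulfI nzl); rewrite mulr0 -[RHS]h; ring.
have branch2 : f^`M(o1).@[P ord0] * s ^+ q + f^`M(o2).@[P ord0] = 0.
  have nzs : s != 0.
    apply: contraNneq ne => s0; rewrite -sq s0 expr0n eqn0Ngt.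
    by rewrite (expn_gt0 2).
  have Xc b : ballico_hefez K q (\row_i (c2 s ord0 i).[b]).
    by rewrite c2E; apply: onB; rewrite nzs.
  have := gradient_along_curve 1 fB Xc; rewrite c2E sum3E !mxE /=.
  rewrite derivC !derivZ derivD !derivZ derivX hornerC.
  rewrite !hornerZ hornerD !hornerZ !derivXE hornerC.
  rewrite q1 q0 !expr1n !mul0r !mulr0 !addr0 !add0r !mulr1 => h.
  by apply: (mulfI nzl); rewrite mulr0 -[RHS]h; ring.
have [g0 g1] : f^`M(o0).@[P ord0] = 0 /\ f^`M(o1).@[P ord0] = 0.
  have h1 := branch1 s erefl.
  have h2 : f^`M(o0).@[P ord0] * s' ^+ q + f^`M(o1).@[P ord0] = 0.
    apply: branch1; congr (_ *: _); apply/rowP; apply: ord3P; rewrite !mxE /=.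
    - by rewrite !exprS sq s'q mulrC.
    - by rewrite !expr1n !mulr1 sq s'q addrC.
    - by [].
  have /eqP : f^`M(o0).@[P ord0] * (s - s') = 0.
    by rewrite -[RHS](subrr 0) -{1}h2 -{1}h1 sq s'q; ring.
  rewrite mulf_eq0 subr_eq0 (negPf ne) orbF => /eqP g0.
  by split=> //; move: h1; rewrite g0 mul0r add0r.
apply: ord3P => //.
by move: branch2; rewrite g1 mul0r add0r.
Qed.

(** To see that such a point is singular, take [u] with [u * (u + 1) = a * c].
    By the telescoped trace, [u ^+ q = u + Tr (a * c) = u + 1], so that the two
    roots [u] and [u + 1] are conjugate, and the parameters [u / c] and
    [(u + 1) / c] both give the point [(a : 1 : c)]. *)
Lemma rational_singular (P : 'rV[F]_3) :
  rational_points iota (Sing (ballico_hefez K (2 ^ e))) P <->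
  exists y a c, [/\ y != 0, abs_trace e (a * c) = 1 & P = y *: vec3 a 1 c].
Proof.
set q := (2 ^ e)%N; split=> [/singular_rational|] [y [a [c [nzy tr]]]].
  move=> /rowP eqP; have:= eqP o0; have:= eqP o1; have:= eqP o2.
  rewrite !mxE /= mulr1 => P2 P1 P0.
  exists (P 0 o1), a, c; split=> //; first by rewrite -(fmorph_eq0 iota) P1.
  by apply/rowP; apply: ord3P; apply: (fmorph_inj iota);
    rewrite !mxE /= ?P0 ?P1 ?P2 ?rmorphM ?P1 ?rmorph1 ?mulr1.
move=> ->; rewrite /rational_points map_mxZ map_vec3 rmorph1.
have nzc : iota c != 0.
  rewrite fmorph_eq0; apply: contra_eq_neq tr => ->.
  by rewrite mulr0 abs_trace_0 eq_sym oner_eq0.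
have [u] := @solve_monicpoly K 2 (nth 0 [:: iota (a * c); 1]) isT.
rewrite !big_ord_recl big_ord0 /= mulr1 mul1r addr0 => uE.
have uac : u * (u + 1) = iota (a * c).
  by rewrite mulrDr mulr1 -expr2 uE -addrA addrr_pchar2 ?ch2 // addr0.
have uq : u ^+ q = u + 1.
  have := abs_trace_artin_schreier ch2 e u; rewrite uac -rmorph_abs_trace tr rmorph1.
  by move=> ->; rewrite addrCA addrr_pchar2 ?ch2 // addr0.
have cq : iota c ^+ q = iota c by rewrite -rmorphXn /q -cardF expf_card.
have sq : (u / iota c) ^+ q = (u + 1) / iota c by rewrite expr_div_n uq cq.
have s'q : ((u + 1) / iota c) ^+ q = u / iota c.
  rewrite expr_div_n expr2XD ?ch2 // -/q uq cq expr1n -addrA.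
  by rewrite addrr_pchar2 ?ch2 // addr0.
have sum1 : u + 1 + u = 1 by rewrite addrAC addrr_pchar2 ?ch2 // add0r.
rewrite (_ : _ *: _ = (iota y * iota c) *: Phi q (u / iota c) 1).
  apply: (node_singular _ sq s'q); first by rewrite mulf_neq0 // fmorph_eq0.
  rewrite -subr_eq0 -mulrBl mulf_neq0 ?invr_eq0 //.
  by rewrite opprD addrA subrr add0r oppr_eq0 oner_eq0.
apply/rowP; apply: ord3P; rewrite !mxE /= ?exprS ?expr1n ?sq ?mulr1.
- rewrite [u / _ * _](_ : _ = iota (a * c) / iota c ^+ 2); last first.
    by rewrite -uac; field.
  by rewrite rmorphM; field.
- by rewrite -mulrDl sum1 mul1r mulfK.
- by [].
Qed.
End Singular.

(** * Counting singular points on lines *)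

Section Counting.
Variables (F : finFieldType) (e : nat).
Hypotheses (e_gt0 : (0 < e)%N) (cardF : #|F| = (2 ^ e)%N).

Let ch2 : 2%N \in [pchar F] := card_finPcharP cardF isT.

Lemma sqr_abs_trace (a : F) : abs_trace e a ^+ 2 = abs_trace e (a ^+ 2).
Proof.
rewrite -[LHS](pFrobenius_autE ch2) rmorph_sum; apply: eq_bigr => i _ /=.
by rewrite pFrobenius_autE -!exprM mulnC.
Qed.

Lemma abs_trace_sqr (a : F) : abs_trace e (a ^+ 2) = abs_trace e a.
Proof.
have aq : a ^+ (2 ^ e) = a by rewrite -cardF expf_card.
have := abs_trace_artin_schreier ch2 e a.
rewrite aq addrr_pchar2 // mulrDr mulr1 (abs_traceD ch2) -expr2.
by move/eqP; rewrite addr_eq0 oppr_pchar2 // => /eqP.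
Qed.

Definition trace1 := [set a : F | abs_trace e a == 1].

(** The trace is a polynomial of degree [2 ^ e.-1]. *)
Lemma card_trace_fiber (b : F) :
  (#|[set a : F | abs_trace e a == b]| <= 2 ^ e.-1)%N.
Proof.
pose p : {poly F} := \sum_(i < e) 'X^(2 ^ i) - b%:P.
have sz : size p = (2 ^ e.-1).+1.
  rewrite /p; case: e e_gt0 => // e' _.
  rewrite big_ord_recr /= -addrA addrC -addrA size_polyDl size_polyXn //.
  rewrite ltnS addrC; apply: leq_trans (size_polyD _ _) _.
  rewrite geq_max size_polyN (leq_trans (size_polyC_leq1 _)) ?expn_gt0 // andbT.
  apply: leq_trans (size_sum _ _ _) _; apply/bigmax_leqP => i _.
  by rewrite size_polyXn ltn_exp2l.
have nzp : p != 0 by rewrite -size_poly_gt0 sz.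
rewrite cardE -ltnS -sz; apply: max_poly_roots nzp _ (enum_uniq _).
apply/allP=> a; rewrite mem_enum inE => /eqP tr.
rewrite /root !hornerE horner_sum -tr subr_eq0; apply/eqP.
by apply: eq_bigr => i _; rewrite hornerXn.
Qed.

(** The trace takes only the values 0 and 1, as it is fixed by squaring; each
    value is taken at most [2 ^ e.-1] times, and [2 ^ e] elements must be shared
    between them, so both bounds are equalities. *)
Lemma card_trace1 : #|trace1| = (2 ^ e.-1)%N.
Proof.
have tr01 (a : F) : (abs_trace e a == 1) = ~~ (abs_trace e a == 0).
  have /eqP : abs_trace e a * (abs_trace e a - 1) = 0.
    by rewrite mulrBr mulr1 -expr2 sqr_abs_trace abs_trace_sqr subrr.
  rewrite mulf_eq0 subr_eq0 => /orP[] /eqP->; rewrite eqxx ?oner_eq0 //.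
  by rewrite eq_sym oner_eq0.
have sum : (#|trace1| + #|[set a : F | abs_trace e a == 0%R]| = 2 ^ e)%N.
  rewrite -cardF -(cardsC trace1); congr (_ + _)%N; apply: eq_card => a.
  by rewrite !inE tr01 negbK.
have : (#|trace1| <= 2 ^ e.-1)%N := card_trace_fiber 1.
have : (#|[set a : F | abs_trace e a == 0%R]| <= 2 ^ e.-1)%N.
  exact: (card_trace_fiber 0).
have qE : (2 ^ e = 2 * 2 ^ e.-1)%N by rewrite -expnS prednK.
by move: sum; rewrite qE; move: #|_| #|_| (2 ^ _)%N; lia.
Qed.

(** The affine coordinates [(x, z)] of the singular points [(x : 1 : z)]. *)
Definition nodes := [set p : F * F | abs_trace e (p.1 * p.2) == 1].

Lemma card_nodes : #|nodes| = ((2 ^ e).-1 * 2 ^ e.-1)%N.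
Proof.
(* A node is determined by [x != 0] and the element [x * z] of trace 1. *)
pose g (p : F * F) := (p.1, p.1^-1 * p.2).
have -> : nodes = g @: setX [set~ 0] trace1.
  apply/setP=> -[x z]; rewrite inE /=; apply/idP/imsetP => [tr|].
    have nzx : x != 0.
      by apply: contraTneq tr => ->; rewrite mul0r abs_trace_0 eq_sym oner_eq0.
    by exists (x, x * z); rewrite ?inE /= ?nzx // /g /= mulKf.
  by move=> [[x' w]]; rewrite !inE /= => /andP[nzx tr] [-> ->]; rewrite mulVKf.
rewrite card_in_imset; first by rewrite cardsX cardsC1 cardF card_trace1.
move=> [x w] [x' w']; rewrite !inE /= => /andP[nzx _] _ [<- eqw].
by rewrite (mulfI _ eqw) // invr_eq0.
Qed.

(** On a line [x = beta + gamma z] the trace of [x z = beta z + gamma z^2] equals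
    that of [(beta^2 + gamma) z^2], so [z] determines the point and
    [z |-> (beta^2 + gamma) z^2] embeds the points on the line into the elements
    of trace 1.  The defining equation of [nodes] is symmetric in [x] and [z],
    which covers the lines [z = const]; the remaining case is a nonzero constant,
    without zeros. *)
Lemma card_line_nodes (a b c : F) : (a, b, c) != (0, 0, 0) ->
  (#|[set p in nodes | a * p.1 + b + c * p.2 == 0]%R| <= 2 ^ e.-1)%N.
Proof.
wlog nza : a c / (a == 0) ==> (c == 0) => [WL|].
  have [a0|nza] := eqVneq a 0; last by apply: WL; rewrite (negPf nza).
  have [c0|nzc] := eqVneq c 0; first by apply: WL; rewrite a0 c0 eqxx.
  move=> nz; have := WL c a; rewrite (negPf nzc) a0 => /(_ isT).
  rewrite !xpair_eqE (negPf nzc) => /(_ isT); apply: leq_trans.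
  have swap_inj : injective (fun p : F * F => (p.2, p.1)).
    by move=> [u v] [u' v'] /= [-> ->].
  rewrite -(card_imset _ swap_inj).
  apply/subset_leq_card/subsetP => _ /imsetP[p + ->].
  by rewrite !inE /= [p.2 * _]mulrC !mul0r add0r addr0 addrC.
have [a0|{}nza] := eqVneq a 0; last first.
  move=> _; pose d := (b / a) ^+ 2 + c / a.
  set Z := [set p in nodes | _].
  have ZE p : p \in Z -> p.1 = b / a + c / a * p.2 /\ d * p.2 ^+ 2 \in trace1.
    rewrite !inE => /andP[/eqP tr /eqP line].
    have p1 : p.1 = b / a + c / a * p.2.
      have /eqP := line; rewrite -addrA addr_eq0 oppr_pchar2 // => /eqP.
      by move/(canRL (mulKf nza)) => ->; field.
    split=> //; apply/eqP; rewrite -[RHS]tr p1.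
    rewrite (_ : d * _ = (b / a * p.2) ^+ 2 + c / a * p.2 ^+ 2); last first.
      by rewrite /d; ring.
    rewrite (abs_traceD ch2) abs_trace_sqr -(abs_traceD ch2).
    by congr abs_trace; ring.
  rewrite -card_trace1 -(@card_in_imset _ _ (fun p => d * p.2 ^+ 2) Z).
    by apply/subset_leq_card/subsetP=> w /imsetP[p /ZE[_ ?] ->].
  move=> p p' /ZE[p1 tr] /ZE[p1' _] /= eqd.
  have nzd : d != 0.
    by apply: contraTneq tr => ->; rewrite inE mul0r abs_trace_0 eq_sym oner_eq0.
  have p2 : p.2 = p'.2.
    by apply: (fmorph_inj (pFrobenius_aut ch2)); apply: (mulfI nzd).
  by case: p p' p1 p1' p2 {tr eqd} => [u v] [u' v'] /= -> -> ->.
move: nza; rewrite a0 eqxx => /eqP->; rewrite !xpair_eqE eqxx andbT /= => nzb.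
rewrite (_ : [set p in _ | _] = set0) ?cards0 //.
by apply/setP=> p; rewrite !inE !mul0r add0r addr0 (negPf nzb) andbF.
Qed.

(** On the line [x = 1] of the affine chart the condition is [Tr z = 1]. *)
Lemma card_line_nodes_eq :
  #|[set p in nodes | 1 * p.1 + 1 + 0 * p.2 == 0]| = (2 ^ e.-1)%N.
Proof.
have pair_inj : injective (fun z : F => (1 : F, z)) by move=> z z' [].
rewrite -card_trace1 -(card_imset trace1 pair_inj).
apply: eq_card => -[x z]; rewrite !inE /= mul0r mul1r addr0 addr_eq0 oppr_pchar2 //.
apply/andP/imsetP => [[tr /eqP x1]|[w]].
  by move: tr; rewrite x1 mul1r => tr; exists z; rewrite ?inE.
by rewrite inE => tr [-> ->]; rewrite mul1r.
Qed.
End Counting.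

(** * The code *)

Lemma dhomog1E (R : nzRingType) n (f : {mpoly R[n]}) :
  f \is 1.-homog -> f = \sum_i f@_U_(i) *: 'X_i.
Proof.
move=> homf; apply/mpolyP => m; rewrite raddf_sum /=.
case: (altP (mdeg1P m)) => [[i /eqP ->]|ne]; last first.
  rewrite (dhomog_nemf_coeff homf ne) big1 // => i _; rewrite mcoeffZ mcoeffX.
  case: eqP => [im|]; last by rewrite mulr0.
  by move: ne; rewrite -im mdeg1.
rewrite (bigD1 i) //= mcoeffZ mcoeffX eqxx mulr1 big1 ?addr0 // => j ne.
rewrite mcoeffZ mcoeffX; case: eqP => [/mnmP/(_ i)|]; last by rewrite mulr0.
by rewrite !mnm1E eqxx (negPf ne).
Qed.

Lemma meval_dhomog1 (F : fieldType) (f : dhomog 3 F 1) v : (mpoly_of_dhomog f).@[v] =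
  (mpoly_of_dhomog f)@_U_(o0) * v o0 + (mpoly_of_dhomog f)@_U_(o1) * v o1
  + (mpoly_of_dhomog f)@_U_(o2) * v o2.
Proof.
rewrite {1}(dhomog1E (dhomog_is_dhomog f)) sum3E !mevalD !mevalZ.
by rewrite !mevalXU.
Qed.

Lemma dhomog1_coef_neq0 (F : fieldType) (f : dhomog 3 F 1) : f != 0 ->
  ((mpoly_of_dhomog f)@_U_(o0), (mpoly_of_dhomog f)@_U_(o1),
   (mpoly_of_dhomog f)@_U_(o2)) != (0, 0, 0).
Proof.
apply: contra_neq => -[f0 f1 f2]; apply: val_inj => /=.
rewrite (dhomog1E (dhomog_is_dhomog f)) sum3E f0 f1 f2.
by rewrite !scale0r !addr0.
Qed.

Lemma hamming_sub (F : fieldType) s (x y : 'rV[F]_s) :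
  hamming x y = #|[set j | (x - y) 0 j != 0]|.
Proof. by apply: eq_card => j; rewrite !inE !mxE subr_eq0. Qed.

Section Code.
Variables (F : finFieldType) (e s : nat) (r : 'I_s -> 'rV[F]_3).
Variable S : projset F.
Hypotheses (e_gt1 : (1 < e)%N) (cardF : #|F| = (2 ^ e)%N).
Hypothesis SE : forall P, S P <->
  exists y a c, [/\ y != 0, abs_trace e (a * c) = 1 & P = y *: vec3 a 1 c].
Hypothesis repr : representatives S r.

Let e_gt0 : (0 < e)%N := ltnW e_gt1.
Let q := (2 ^ e)%N.
Let m := (2 ^ e.-1)%N.

Definition chart (j : 'I_s) : F * F :=
  (r j 0 o0 / r j 0 o1, r j 0 o2 / r j 0 o1).

Lemma chartP j : [/\ r j = r j 0 o1 *: vec3 (chart j).1 1 (chart j).2,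
  r j 0 o1 != 0 & chart j \in nodes F e].
Proof.
have [rS _ _] := repr.
have [_ /SE [y [a [c [nzy tr rj]]]]] := rS j.
have r1 : r j 0 o1 = y by rewrite rj !mxE /= mulr1.
have -> : chart j = (a, c).
  by rewrite /chart r1 rj !mxE /= ![y * _]mulrC !mulfK.
by rewrite r1 inE /= tr eqxx.
Qed.

Lemma chart_inj : injective chart.
Proof.
move=> j k eqc; have [_ + _] := repr; apply.
have [rj nzj _] := chartP j; have [rk nzk _] := chartP k.
by rewrite rj rk eqc !eqmx_scale // submx_refl.
Qed.

Lemma chart_onto p : p \in nodes F e -> exists j, chart j = p.
Proof.
case: p => a c; rewrite inE /= => /eqP tr.
have Sp : S (1 *: vec3 a 1 c) by apply/SE; exists 1, a, c; rewrite oner_eq0.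
have [_ _ /(_ _ Sp)[j]] := repr; rewrite scale1r => /eqmx_rowP[|l nzl rj].
  by apply/eqP => /rowP/(_ o1)/eqP; rewrite !mxE /= oner_eq0.
exists j; have [rjE nzr _] := chartP j.
have := rj; rewrite rjE !scale_vec3 mulr1 => /rowP vE.
have := vE o0; have := vE o1; have := vE o2; rewrite !mxE /= => -> e1 ->.
by rewrite !mulrA -e1 !mul1r.
Qed.

Lemma card_chart (Q : pred (F * F)) :
  #|[set j | Q (chart j)]| = #|[set p in nodes F e | Q p]|.
Proof.
rewrite -(card_imset _ chart_inj); apply: eq_card => p; rewrite inE.
apply/imsetP/andP => [[j + ->]|[/chart_onto[j <-] Qj]].
  by rewrite inE; have [_ _ ->] := chartP j.
by exists j; rewrite ?inE.
Qed.

Lemma length_nodes : s = (q.-1 * m)%N.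
Proof.
rewrite -(card_nodes e_gt0 cardF) -[LHS]card_ord -cardsT.
have := card_chart predT.
rewrite (eq_card (B := setT)) => [->|j]; last by rewrite !inE.
by apply: eq_card => p; rewrite !inE andbT.
Qed.

(** Rescaling the coordinates of a point multiplies the value of a form by a
    nonzero factor, so the zero entries of a codeword can be counted in the
    affine chart, whichever representatives are chosen. *)
Lemma weight_evalS (f : dhomog 3 F 1) (a b c : F) :
    (forall v, (mpoly_of_dhomog f).@[v] = a * v o0 + b * v o1 + c * v o2) ->
  (#|[set j | evalS r f ord0 j != 0%R]|
   + #|[set p in nodes F e | a * p.1 + b + c * p.2 == 0]%R| = q.-1 * m)%N.
Proof.
move=> fE; rewrite -length_nodes -[RHS]card_ord.
pose line (p : F * F) := a * p.1 + b + c * p.2 == 0.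
rewrite -(card_chart line) addnC -(cardsC [set j | line (chart j)]).
congr (_ + _)%N; apply: eq_card => j; rewrite !inE mxE fE.
have [rj nzr _] := chartP j.
have rc i : r j ord0 i = r j 0 o1 * vec3 (chart j).1 1 (chart j).2 0 i.
  by rewrite {1}rj mxE.
rewrite (rc o0) (rc o2); move: (chart j) => [x z]; rewrite !mxE /line /=.
set lhs := (X in X != 0); set rhs := (X in _ = ~~ (X == 0)).
have -> : lhs = r j 0 o1 * rhs by rewrite /lhs /rhs; ring.
by rewrite mulf_eq0 (negPf nzr).
Qed.

Lemma predq : q.-1 = q.-2.+1.
Proof.
have : (2 ^ 1 < q)%N by rewrite ltn_exp2l.
by case: q => [|[]].
Qed.

Lemma weight_ge (f : dhomog 3 F 1) : f != 0 ->
  (q.-2 * m <= #|[set j | evalS r f ord0 j != 0%R]|)%N.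
Proof.
move/dhomog1_coef_neq0/(card_line_nodes e_gt0 cardF).
have := weight_evalS (meval_dhomog1 f); rewrite -/m predq mulSn.
by move: #|_| #|_| (_ * m)%N; lia.
Qed.

Lemma weight_attained :
  exists f : dhomog 3 F 1, #|[set j | evalS r f ord0 j != 0]| = (q.-2 * m)%N.
Proof.
have homf : 'X_o0 + 'X_o1 \is [in F[3], 1.-homog].
  by rewrite rpredD // dhomogX /= mdeg1.
exists (DHomog homf).
have := @weight_evalS (DHomog homf) 1 1 0.
rewrite (card_line_nodes_eq e_gt0 cardF) predq mulSn addnC => /(_ _)/addnI; apply.
by move=> v; rewrite mevalD !mevalXU !mul1r mul0r addr0.
Qed.

(** The bound [q.-2 * m] is positive, because [2 < q]. *)
Lemma evalS_neq0 (f : dhomog 3 F 1) :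
  (q.-2 * m <= #|[set j | evalS r f ord0 j != 0%R]|)%N -> evalS r f != 0.
Proof.
apply: contraTneq => ->; rewrite -ltnNge.
rewrite (_ : [set j | _] = set0) ?cards0; last first.
  by apply/setP=> j; rewrite !inE mxE eqxx.
have : (2 ^ 1 < q)%N by rewrite ltn_exp2l.
by rewrite muln_gt0 expn_gt0 andbT; case: q => [|[|[]]].
Qed.

(** By the weight bound evaluation is injective, and the space of linear forms in
    three variables has dimension 3. *)
Lemma dim_C_L1 : \dim (C_L r 1) = 3.
Proof.
rewrite /C_L limg_dim_eq; first by rewrite dimvf.
apply/eqP; rewrite -subv0; apply/subvP => f.
rewrite memv_cap memv_ker lfunE /= memv0.
by move=> /andP[_]; apply: contraTT => /weight_ge/evalS_neq0.
Qed.

Lemma min_distance_C_L1 : min_distance (C_L r 1) (q.-2 * m).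
Proof.
split.
  have [f wf] := weight_attained; exists (evalS r f), 0.
  have fC : evalS r f \in C_L r 1 by apply/C_LP; exists f.
  split; rewrite ?mem0v //; last by rewrite hamming_sub subr0.
  by apply: evalS_neq0; rewrite wf.
move=> _ _ /C_LP[f ->] /C_LP[g ->] ne; rewrite hamming_sub -linearB.
by apply: weight_ge; rewrite subr_eq0; apply: contraNneq ne => ->.
Qed.
End Code.

(** With [q = 2 m] the distance is [(m - 1) q], so the three terms are
    [(m - 1) q], [m - 1], and 1, the last because [0 < (m - 1) / q <= 1]. *)
Lemma griesmer_numbers e : (1 < e)%N -> let q := (2 ^ e)%N in
  achieves_griesmer q (q.-1 * 2 ^ e.-1) 3 (q.-2 * 2 ^ e.-1).
Proof.
move=> e_gt1 q; set m := (2 ^ e.-1)%N.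
have qE : q = (2 * m)%N by rewrite -expnS prednK // ltnW.
have m_gt1 : (1 < m)%N by rewrite -(expn0 2) ltn_exp2l // -ltnS prednK // ltnW.
have dE : (q.-2 * m = m.-1 * q)%N by rewrite qE; move: m_gt1; nia.
have q_gt0 : 0 < q%:R :> rat by rewrite ltr0n expn_gt0.
have nzq : q%:R != 0 :> rat by rewrite lt0r_neq0.
rewrite /achieves_griesmer !big_ord_recl big_ord0 /= /bump /= expr0 divr1 expr1.
have -> : (q.-2 * m)%:R / q%:R = m.-1%:R :> rat by rewrite dE natrM mulfK.
have -> : (q.-2 * m)%:R / q%:R ^+ 2 = m.-1%:R / q%:R :> rat.
  by rewrite dE natrM; field.
rewrite !pmulrn !intrKceil (@ceil_def _ _ 1).
  by rewrite -!PoszD; congr Posz; rewrite dE qE; move: m_gt1; nia.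
have m1_gt0 : (0 < m.-1)%N by rewrite -ltnS prednK // ltnW.
rewrite subrr -!pmulrn divr_gt0 ?ltr0n ?expn_gt0 //=.
by rewrite ler_pdivrMr // mul1r ler_nat qE; lia.
Qed.

Local Close Scope ring_scope.

Theorem proposition5p3 (F : finFieldType) (K : closedFieldType)
    (iota : {rmorphism F -> K}) (q e : nat)
    (he : (2 < e)%N) (hq : q = (2 ^ e)%N) (hF : #|F| = q)
    (hK : is_alg_closure iota) :
  all_rational iota (Sing (ballico_hefez K q)) /\
  forall (s : nat) (r : 'I_s -> 'rV[F]_3),
    representatives (rational_points iota (Sing (ballico_hefez K q))) r ->
    is_code (C_L r 1) ((q ^ 2 - q) %/ 2) 3 ((q ^ 2 - 2 * q) %/ 2) /\
    achieves_griesmer q ((q ^ 2 - q) %/ 2) 3 ((q ^ 2 - 2 * q) %/ 2).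
Proof.
rewrite {}hq in hF *; have e_gt1 := ltnW he; have e_gt0 := ltnW e_gt1.
have qE : (2 ^ e = 2 * 2 ^ e.-1)%N by rewrite -expnS prednK.
have nE : (((2 ^ e) ^ 2 - 2 ^ e) %/ 2 = (2 ^ e).-1 * 2 ^ e.-1)%N.
  by rewrite qE; move: (2 ^ e.-1)%N; nia.
have dE : (((2 ^ e) ^ 2 - 2 * 2 ^ e) %/ 2 = (2 ^ e).-2 * 2 ^ e.-1)%N.
  by rewrite qE; move: (2 ^ e.-1)%N; nia.
rewrite nE dE; split.
  move=> P /(singular_rational iota e_gt0 hF)[y [a [c [nzy _ ->]]]].
  exists (vec3 a 1 c); rewrite map_vec3 rmorph1; exact: eqmx_scale_row.
move=> s r repr; split; last exact: griesmer_numbers.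
have SE := rational_singular iota e_gt0 hF.
split; first exact: (length_nodes e_gt1 hF SE repr).
  exact: (dim_C_L1 e_gt1 hF SE repr).
exact: (min_distance_C_L1 e_gt1 hF SE repr).
Qed.
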